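(* Let $a_n$ be the number of inversion sequences of size $n$ avoiding both patterns $201$ and $210$. Then $$\sum_{n\geqslant 0} a_n t^n = \frac{2-t-t\sqrt{1-8t}}{4t^2 - 4t + 2}.$$
   Context: An inversion sequence of size $n$ is a sequence $\sigma=(\sigma_1,\dots,\sigma_n)$ of integers with $\sigma_i\in\{0,\dots,i-1\}$ for all $i$ (the empty sequence is the unique one of size $0$). A sequence contains the pattern $201$ (resp. $210$) if it has entries at positions $a<b<c$ with $\sigma_b<\sigma_c<\sigma_a$ (resp. $\sigma_c<\sigma_b<\sigma_a$); otherwise it avoids it. The identity is one of formal power series in $t$. *)

(* Defs.v *)
From HB Require Import structures.
From mathcomp Require Import all_boot all_order all_algebra.
From mathcomp Require Import boolp.

Set Implicit Arguments.
Unset Strict Implicit.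
Unset Printing Implicit Defensive.
Import GRing.Theory.

(* Positions are indexed from 0, so that sigma_i in {0, ..., i-1} for 1 <= i    *)
(* becomes s i <= i for i : 'I_n; the codomain 'I_n then loses nothing.        *)
Definition inversion_sequence n (s : {ffun 'I_n -> 'I_n}) : bool :=
  [forall i : 'I_n, s i <= i].

Definition contains201 n (s : {ffun 'I_n -> 'I_n}) : bool :=
  [exists a : 'I_n, exists b : 'I_n, exists c : 'I_n,
    [&& a < b, b < c, s b < s c & s c < s a]].

Definition contains210 n (s : {ffun 'I_n -> 'I_n}) : bool :=
  [exists a : 'I_n, exists b : 'I_n, exists c : 'I_n,
    [&& a < b, b < c, s c < s b & s b < s a]].

Definition num_avoiding n : nat :=
  #|[set s : {ffun 'I_n -> 'I_n} |
      [&& inversion_sequence s, ~~ contains201 s & ~~ contains210 s]]|.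

Local Open Scope ring_scope.

(* Formal power series over a field; Fps a is \sum_n (a n) t^n. *)
Record fps (K : Type) := Fps { fpscoef : nat -> K }.

HB.instance Definition _ (K : Type) := [isNew for @fpscoef K].
HB.instance Definition _ (K : choiceType) :=
  [Equality of fps K by <:].
HB.instance Definition _ (K : choiceType) := [Choice of fps K by <:].

Notation "f `[ n ]" := (fpscoef f n)
  (at level 2, left associativity, format "f `[ n ]") : ring_scope.

Lemma fpsP (K : Type) (f g : fps K) : (forall n, f`[n] = g`[n]) <-> f = g.
Proof.
split=> [|-> //]; case: f g => [f] [g] /= fg.
by congr Fps; apply: funext.
Qed.

(* Course-of-values recursion: rec_seq step n = step [:: u_0; ...; u_(n-1)],   *)
(* where u_i = rec_seq step i.                                                 *)
Fixpoint rec_prefix (K : Type) (step : seq K -> K) (n : nat) : seq K :=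
  if n is m.+1 then
    rcons (rec_prefix step m) (step (rec_prefix step m))
  else [::].

Definition rec_seq (K : Type) (step : seq K -> K) (n : nat) : K :=
  step (rec_prefix step n).

Lemma size_rec_prefix (K : Type) (step : seq K -> K) n :
  size (rec_prefix step n) = n.
Proof. by elim: n => //= n IHn; rewrite size_rcons IHn. Qed.

Lemma nth_rec_prefix (K : Type) (step : seq K -> K) x0 n i :
  (i < n)%N -> nth x0 (rec_prefix step n) i = rec_seq step i.
Proof.
elim: n => //= n IHn; rewrite ltnS nth_rcons size_rec_prefix => le_in.
by case: ltngtP le_in => // [lt_in _|-> _]; first exact: IHn.
Qed.

Section FpsRing.

Variable K : fieldType.
Implicit Types f g h : fps K.

Definition fps_zero : fps K := Fps (fun=> 0).
Definition fps_opp f : fps K := Fps (fun n => - f`[n]).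
Definition fps_add f g : fps K := Fps (fun n => f`[n] + g`[n]).

Fact fps_addA : associative fps_add.
Proof. by move=> f g h; apply/fpsP => n /=; rewrite addrA. Qed.
Fact fps_addC : commutative fps_add.
Proof. by move=> f g; apply/fpsP => n /=; rewrite addrC. Qed.
Fact fps_add0 : left_id fps_zero fps_add.
Proof. by move=> f; apply/fpsP => n /=; rewrite add0r. Qed.
Fact fps_addN : left_inverse fps_zero fps_opp fps_add.
Proof. by move=> f; apply/fpsP => n /=; rewrite addNr. Qed.

HB.instance Definition _ :=
  GRing.isZmodule.Build (fps K) fps_addA fps_addC fps_add0 fps_addN.

Definition fps_one : fps K := Fps (fun n => (n == 0%N)%:R).
Definition fps_mul f g : fps K :=
  Fps (fun n => \sum_(i < n.+1) f`[i] * g`[n - i]).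

Lemma fps_mul_poly f g N n : (n < N)%N ->
  (fps_mul f g)`[n] =
  ((\poly_(i < N) f`[i]) * (\poly_(i < N) g`[i]))`_n.
Proof.
move=> lt_nN; rewrite coefM /=; apply: eq_bigr => i _.
have lt_iN : (i < N)%N by apply: leq_trans (ltn_ord i) lt_nN.
by rewrite !coef_poly lt_iN (leq_ltn_trans (leq_subr _ _) lt_nN).
Qed.

Fact fps_mulC : commutative fps_mul.
Proof.
move=> f g; apply/fpsP => n.
by rewrite !(fps_mul_poly _ _ (ltnSn n)) mulrC.
Qed.

Fact fps_mulA : associative fps_mul.
Proof.
move=> f g h; apply/fpsP => n.
set P := fun f : fps K => \poly_(i < n.+1) f`[i].
have PM f1 f2 i : (i < n.+1)%N -> (P (fps_mul f1 f2))`_i = (P f1 * P f2)`_i.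
  by move=> lt_in; rewrite coef_poly lt_in (fps_mul_poly _ _ lt_in).
rewrite !(fps_mul_poly _ _ (ltnSn n)) -/(P _) -/(P f) -/(P h) -/(P (fps_mul f g)).
transitivity ((P f * (P g * P h))`_n).
  rewrite !coefM; apply: eq_bigr => i _; congr (_ * _).
  by rewrite -/(P _) PM // ltnS leq_subr.
rewrite mulrA !coefM; apply: eq_bigr => i _; congr (_ * _).
by rewrite PM.
Qed.

Fact fps_mul1 : left_id fps_one fps_mul.
Proof.
move=> f; apply/fpsP => n /=.
rewrite big_ord_recl /= mul1r subn0 big1 ?addr0 // => i _.
by rewrite mul0r.
Qed.

Fact fps_mulDl : left_distributive fps_mul fps_add.
Proof.
move=> f g h; apply/fpsP => n /=.
by rewrite -big_split /=; apply: eq_bigr => i _; rewrite mulrDl.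
Qed.

Fact fps_one_neq0 : fps_one != 0.
Proof.
apply/eqP => /fpsP/(_ 0%N) /= /eqP.
by rewrite (oner_eq0 K).
Qed.

HB.instance Definition _ := GRing.Zmodule_isComNzRing.Build (fps K)
  fps_mulA fps_mulC fps_mul1 fps_mulDl fps_one_neq0.

Lemma fpscoefM f g n : (f * g)`[n] = \sum_(i < n.+1) f`[i] * g`[n - i].
Proof. by []. Qed.

Lemma fpscoefM0 f g : (f * g)`[0] = f`[0] * g`[0].
Proof. by rewrite fpscoefM big_ord1. Qed.

Definition fps_unit : {pred fps K} := [pred f : fps K | f`[0] != 0].

(* The coefficient of degree n > 0 of f^-1 * f = 1, solved for (f^-1)_n. *)
Definition fps_inv_step f (s : seq K) : K :=
  if s is [::] then (f`[0])^-1
  else - (f`[0])^-1 * \sum_(j < size s) s`_j * f`[size s - j].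

Definition fps_inv f : fps K :=
  if f`[0] == 0 then f else Fps (rec_seq (fps_inv_step f)).

Fact fps_mulVf : {in fps_unit, left_inverse 1 fps_inv *%R}.
Proof.
move=> f; rewrite inE => f0; rewrite /fps_inv (negbTE f0).
apply/fpsP => -[|n]; first by rewrite fpscoefM0 /= mulVf.
rewrite fpscoefM big_ord_recr /= subnn /rec_seq /fps_inv_step.
set s := rec_prefix _ n.+1.
have szs : size s = n.+1 by apply: size_rec_prefix.
have -> : (if s is [::] then (f`[0])^-1
  else - (f`[0])^-1 * \sum_(j < size s) s`_j * f`[size s - j])
  = - (f`[0])^-1 * \sum_(j < n.+1) s`_j * f`[n.+1 - j].
  by rewrite -szs; case: (s) szs.
rewrite mulNr mulNr mulrAC mulVf // mul1r; apply/eqP; rewrite subr_eq0.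
by apply/eqP/eq_bigr => i _; rewrite nth_rec_prefix.
Qed.

Fact fps_unitPl f g : g * f = 1 -> fps_unit f.
Proof.
move=> gf1; have : (g * f)`[0] = 1 by rewrite gf1.
rewrite fpscoefM0 /= => gf0; apply/negP => /eqP f0.
by move/eqP: gf0; rewrite f0 mulr0 eq_sym oner_eq0.
Qed.

Fact fps_inv_out : {in [predC fps_unit], fps_inv =1 id}.
Proof. by move=> f; rewrite !inE negbK /fps_inv => ->. Qed.

HB.instance Definition _ := GRing.ComNzRing_hasMulInverse.Build (fps K)
  fps_mulVf fps_unitPl fps_inv_out.

Lemma fps_unitE f : (f \is a GRing.unit) = (f`[0] != 0).
Proof. by []. Qed.

Definition fpsX : fps K := Fps (fun n => (n == 1%N)%:R).

(* For f with constant term 1 and 2 != 0 in K, the square root of f with       *)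
(* constant term 1 (see fps_sqrtK and fps_sqrt_unique).                        *)
Definition fps_sqrt_step f (s : seq K) : K :=
  if s is [::] then 1
  else 2^-1 * (f`[size s] - \sum_(1 <= j < size s) s`_j * s`_(size s - j)).

Definition fps_sqrt f : fps K := Fps (rec_seq (fps_sqrt_step f)).

Lemma fps_sqrt0 f : (fps_sqrt f)`[0] = 1.
Proof. by []. Qed.

Lemma fps_sqrtK f : 2 != 0 :> K -> f`[0] = 1 -> fps_sqrt f ^+ 2 = f.
Proof.
move=> two_neq0 f0; rewrite expr2; apply/fpsP => -[|n].
  by rewrite fpscoefM0 /= mulr1.
have coefS : (fps_sqrt f)`[n.+1] = 2^-1 * (f`[n.+1] -
    \sum_(1 <= j < n.+1) (fps_sqrt f)`[j] * (fps_sqrt f)`[n.+1 - j]).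
  rewrite {1}/fps_sqrt /= /rec_seq /fps_sqrt_step.
  set s := rec_prefix _ n.+1.
  have szs : size s = n.+1 by apply: size_rec_prefix.
  have -> : \sum_(1 <= j < n.+1) (fps_sqrt f)`[j] * (fps_sqrt f)`[n.+1 - j] =
            \sum_(1 <= j < n.+1) s`_j * s`_(n.+1 - j).
    rewrite !big_nat; apply: eq_bigr => j /andP[j_gt0 lt_jn].
    by rewrite /s !nth_rec_prefix // ltn_subrL j_gt0.
  by rewrite -szs; case: (s) szs.
rewrite fpscoefM -(big_mkord xpredT
  (fun i => (fps_sqrt f)`[i] * (fps_sqrt f)`[n.+1 - i])).
rewrite big_nat_recr // big_ltn // subnn subn0 fps_sqrt0 mul1r mulr1.
rewrite [LHS]addrAC -mulr2n -mulr_natl [in 2 * _]coefS mulrA mulfV // mul1r.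
by rewrite subrK.
Qed.

Lemma fps_sqrt_unique f g : 2 != 0 :> K -> g`[0] = 1 -> g ^+ 2 = f ->
  g = fps_sqrt f.
Proof.
move=> two_neq0 g0 gf.
have f0 : f`[0] = 1 by rewrite -gf expr2 fpscoefM0 g0 mulr1.
have unitD : g + fps_sqrt f \is a GRing.unit.
  by rewrite fps_unitE [X in X != 0]/= g0.
apply/eqP; rewrite -subr_eq0 -(mulIr_eq0 _ (mulIr unitD)) -subr_sqr.
by rewrite gf fps_sqrtK // subrr.
Qed.

End FpsRing.

(* Main.v *)
Require Import Defs.
From mathcomp Require Import all_boot all_order all_algebra.
From mathcomp Require Import zify ring.
Import GRing.Theory.
Local Open Scope ring_scope.

(* A word avoids 201 and 210 when, for each position a, the later entries      *)
(* smaller than the a-th one are all equal. Let M be the maximum of such a     *)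
(* word of size n, k the number of values below M that may be appended, and    *)
(* l = n - M. Appending a value below M leads from (k, l) to (1, l + 1), and   *)
(* appending M + j leads to (k + j, l + 1 - j), so the extensions are counted  *)
(* by a recursion on (k, l). Its generating function in the length is a power  *)
(* series G(k, l) determined by a linear system. The kernel polynomial         *)
(* x^2 - x^3 - 3tx + tx^2 + 2t^2 of this system is (x - t)(x - x^2 - 2t), and  *)
(* the inverse mu of the root of x - x^2 - 2t that is a unit satisfies         *)
(* mu = 1 + 2t mu^2. This gives                                                *)
(*   G(k, l) = (1 + mu^l + 2t(k - 1)mu^(l + 1)) / (2(1 - t - t mu)),           *)
(* and G(0, 0) is the series sought.                                           *)

(** [num_ext_step] proves the branching rule and [num_avoidingE] reduces the count to
    [num_ext n 0 0]. As [num_ext_fps] gives uniqueness for the linear system, the kernel serves only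
    to find the formula, which [closed_form_step] verifies directly. *)

Section Words.
Local Open Scope nat_scope.

(* v can follow w without completing an occurrence of 201 or 210; the bound   *)
(* v <= size w is imposed separately. *)
Definition admissible (w : seq nat) (v : nat) : bool :=
  pairwise (fun x y => ~~ [&& y < x, v < x & y != v]) w.

Definition maxw (w : seq nat) : nat := \max_(x <- w) x.

Fixpoint words (n : nat) : seq (seq nat) :=
  if n is m.+1 then
    flatten [seq [seq rcons w v | v <- iota 0 m.+1 & admissible w v]
            | w <- words m]
  else [:: [::]].

Definition num_low (w : seq nat) : nat :=
  count (admissible w) (iota 0 (maxw w)).

(* Number of extensions by m letters from the state (k, l). *)
Fixpoint num_ext (m k l : nat) : nat :=
  if m is m'.+1 then
    k * num_ext m' 1 l.+1 + \sum_(j < l.+1) num_ext m' (k + j) (l.+1 - j)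
  else 1.

(** * Effect of an appended letter on the state *)

Lemma maxw_rcons w v : maxw (rcons w v) = maxn (maxw w) v.
Proof. by rewrite /maxw -cats1 big_cat big_seq1. Qed.

Lemma le_maxw w x : x \in w -> x <= maxw w.
Proof. by move=> xw; rewrite /maxw (big_rem x) //= leq_maxl. Qed.

Lemma mem_maxw w : 0 < maxw w -> maxw w \in w.
Proof.
elim: w => [|x w IHw]; first by rewrite /maxw big_nil.
have -> : maxw (x :: w) = maxn x (maxw w) by rewrite /maxw big_cons.
rewrite inE; case: (leqP (maxw w) x) => [_|ltx _]; first by rewrite eqxx.
by rewrite IHw ?orbT // (leq_ltn_trans _ ltx).
Qed.

Lemma admissible_ge_max w v : maxw w <= v -> admissible w v.
Proof.
move=> le_v; apply/(pairwiseP 0) => i j lti ltj _.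
have /= := le_maxw _ _ (mem_nth 0 lti); lia.
Qed.

(** Among the earlier letters, the maximum is the one most likely to complete a pattern with [v] and
    [u], so it alone needs testing. *)
Lemma admissible_rcons w v u : admissible (rcons w v) u =
  admissible w u && ~~ [&& v < maxw w, u < maxw w & v != u].
Proof.
rewrite /admissible pairwise_rcons andbC; congr andb.
apply/allP/idP => [H|H x /le_maxw /=]; last lia.
apply/negP => /and3P[ltv ltu neq].
by have := H _ (mem_maxw _ (leq_ltn_trans (leq0n v) ltv)); rewrite ltv ltu neq.
Qed.

Lemma num_low_rcons_lt w v : v < maxw w -> admissible w v ->
  num_low (rcons w v) = 1.
Proof.
move=> ltv av; rewrite /num_low maxw_rcons (maxn_idPl (ltnW ltv)).
have -> : 1 = count_mem v (iota 0 (maxw w)).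
  by rewrite count_uniq_mem ?iota_uniq // mem_iota ltv.
apply: eq_in_count => u; rewrite mem_iota /= add0n => ltu.
rewrite admissible_rcons ltv ltu /= negbK eq_sym.
by case: eqVneq => [->|]; rewrite ?av ?andbF.
Qed.

Lemma num_low_rcons_ge w j :
  num_low (rcons w (maxw w + j)) = num_low w + j.
Proof.
rewrite /num_low maxw_rcons (maxn_idPr (leq_addr _ _)) iotaD count_cat.
congr addn.
  by apply: eq_count => u; rewrite admissible_rcons ltnNge leq_addr andbT.
rewrite -[RHS](size_iota (0 + maxw w)); apply/eqP; rewrite -all_count.
apply/allP => u; rewrite mem_iota add0n => /andP[leu _].
rewrite admissible_rcons ltnNge leq_addr andbT.
exact: admissible_ge_max.
Qed.

Lemma num_ext_step m w : maxw w <= size w ->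
  num_ext m.+1 (num_low w) (size w - maxw w) =
  \sum_(v <- iota 0 (size w).+1 | admissible w v)
    num_ext m (num_low (rcons w v)) (size (rcons w v) - maxw (rcons w v)).
Proof.
move=> leM; set n := size w in leM *; set M := maxw w in leM *.
have -> : n.+1 = M + (n - M).+1 by lia.
(* Letters below the maximum all lead to the same state; the others are [M + j]. *)
rewrite iotaD add0n big_cat; congr addn.
  rewrite big_seq_cond (eq_bigr (fun=> num_ext m 1 (n - M).+1)); last first.
    move=> v /andP[]; rewrite mem_iota add0n => ltv av.
    rewrite num_low_rcons_lt // maxw_rcons size_rcons -/M (maxn_idPl _); last by lia.
    by congr num_ext; rewrite -/n; lia.
  by rewrite -big_seq_cond big_const_seq -/M iter_addn_0 mulnC.
rewrite -[X in iota X](addn0 M) (iotaDl M 0) big_map big_mkcond.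
rewrite -(big_mkord xpredT (fun j => num_ext m (num_low w + j) ((n - M).+1 - j))).
rewrite /index_iota subn0.
apply: eq_bigr => j _; rewrite admissible_ge_max ?leq_addr //.
rewrite num_low_rcons_ge size_rcons maxw_rcons (maxn_idPr (leq_addr _ _)).
by congr num_ext; rewrite -/n -/M; lia.
Qed.

(** * Words and inversion sequences *)

Lemma mem_wordsS n w v : (rcons w v \in words n.+1) =
  [&& w \in words n, v <= n & admissible w v].
Proof.
apply/flatten_mapP/and3P => [[w' w'n]|[wn lev av]].
  case/mapP => v'; rewrite mem_filter mem_iota => /andP[av /andP[_ ltv]].
  by move=> /rcons_inj[-> ->]; split.
exists w => //; apply/mapP; exists v => //.
by rewrite mem_filter av mem_iota.
Qed.

Lemma mem_words n w : w \in words n = (size w == n) &&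
  [forall i : 'I_n, (nth 0 w i <= i) && admissible (take i w) (nth 0 w i)].
Proof.
elim: n w => [|n IHn] w.
  rewrite inE -size_eq0; case: eqP => //= _; apply/esym/forallP; case=> //.
case/lastP: w => [|w v].
  apply/negP => /flatten_mapP[w' _ /mapP[v _]].
  by move/(congr1 size); rewrite size_rcons.
rewrite mem_wordsS IHn size_rcons eqSS -andbA; case: eqP => //= szw.
apply/andP/forallP => [[/forallP H /andP[lev av]] i|H].
  have [lti|] := ltnP i n.
    rewrite nth_rcons szw lti -cats1 takel_cat ?szw ?(ltnW lti) //.
    exact: (H (Ordinal lti)).
  move=> lei; have -> : (i = size w :> nat).
    by apply/eqP; rewrite eqn_leq szw lei -ltnS ltn_ord.
  rewrite nth_rcons ltnn eqxx -cats1 take_size_cat // szw.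
  by rewrite lev.
split.
  apply/forallP => i; have := H (widen_ord (leqnSn n) i) => /=.
  by rewrite nth_rcons szw ltn_ord -cats1 takel_cat ?szw ?(ltnW (ltn_ord i)).
by have := H ord_max; rewrite /= nth_rcons szw ltnn eqxx -cats1 take_size_cat.
Qed.

Lemma words_uniq n : uniq (words n).
Proof.
elim: n => //= n IHn; apply: allpairs_uniq_dep => //.
  by move=> w _; exact: filter_uniq (iota_uniq 0 n.+1).
by move=> [w v] [w' v'] _ _ /= /rcons_inj[-> ->].
Qed.

Lemma size_words n w : w \in words n -> size w = n.
Proof. by rewrite mem_words => /andP[/eqP]. Qed.

Lemma maxw_words n w : w \in words n -> maxw w <= n.
Proof.
rewrite mem_words => /andP[/eqP szw /forallP H].
rewrite /maxw; apply/bigmax_leqP_seq => x /(nthP 0)[i].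
rewrite szw => lti <- _; have /andP[] := H (Ordinal lti) => /=; lia.
Qed.

Lemma sum_num_ext n m : \sum_(w <- words n)
  num_ext m (num_low w) (size w - maxw w) = num_ext (n + m) 0 0.
Proof.
elim: n m => [|n IHn] m.
  by rewrite /= big_seq1 /num_low /maxw big_nil.
rewrite addSnnS -IHn big_flatten big_map; apply: eq_big_seq => w wn.
rewrite num_ext_step ?(size_words _ _ wn) ?maxw_words //.
by rewrite big_map big_filter.
Qed.

Lemma size_wordsE n : size (words n) = num_ext n 0 0.
Proof. by rewrite -[n in RHS]addn0 -sum_num_ext /= sum1_size. Qed.

Definition word_of n (s : {ffun 'I_n -> 'I_n}) : seq nat :=
  [seq val (s i) | i <- enum 'I_n].

Lemma size_word_of n (s : {ffun 'I_n -> 'I_n}) : size (word_of n s) = n.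
Proof. by rewrite size_map size_enum_ord. Qed.

Lemma nth_word_of n (s : {ffun 'I_n -> 'I_n}) (i : 'I_n) :
  nth 0 (word_of n s) i = s i.
Proof. by rewrite (nth_map i) ?size_enum_ord // nth_ord_enum. Qed.

Lemma word_of_inj n : injective (word_of n).
Proof.
move=> s s' eqs; apply/ffunP => i; apply: val_inj.
by rewrite /= -!nth_word_of eqs.
Qed.

(** Two unequal later entries below an earlier one form 201 or 210, according to their order. *)
Lemma word_of_in_words n (s : {ffun 'I_n -> 'I_n}) :
  (word_of n s \in words n) =
  [&& inversion_sequence s, ~~ contains201 s & ~~ contains210 s].
Proof.
rewrite mem_words size_word_of eqxx /=.
apply/forallP/and3P => [H|[/forallP inv av201 av210] c].
  have key (a b c : 'I_n) : a < b -> b < c -> s b < s a -> s c < s a ->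
      s b = s c :> nat.
    move=> ab bc sba sca; have /andP[_ /(pairwiseP 0) ac] := H c.
    have := ac a b; rewrite !inE !size_take !size_word_of ltn_ord.
    rewrite !nth_take ?(ltn_trans ab bc) // !nth_word_of bc ab sba sca.
    by move=> /(_ isT isT isT); rewrite negbK => /eqP.
  split; first by apply/forallP => i; have /andP[] := H i; rewrite nth_word_of.
    apply/existsP => -[a /existsP[b /existsP[c /and4P[ab bc sbc sca]]]].
    by have := key a b c ab bc (ltn_trans sbc sca) sca; lia.
  apply/existsP => -[a /existsP[b /existsP[c /and4P[ab bc scb sba]]]].
  by have := key a b c ab bc sba (ltn_trans scb sba); lia.
rewrite nth_word_of inv; apply/(pairwiseP 0) => a b.
rewrite !inE !size_take !size_word_of ltn_ord => ac bc ab.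
rewrite !nth_take //.
have an := ltn_trans ac (ltn_ord c); have bn := ltn_trans bc (ltn_ord c).
rewrite (nth_word_of _ s (Ordinal an)) (nth_word_of _ s (Ordinal bn)).
apply/negP => /and3P[sba sca]; rewrite neq_ltn => /orP[lt_bc|lt_cb].
  case/negP: av201; apply/existsP; exists (Ordinal an).
  by apply/existsP; exists (Ordinal bn); apply/existsP; exists c; apply/and4P.
case/negP: av210; apply/existsP; exists (Ordinal an).
by apply/existsP; exists (Ordinal bn); apply/existsP; exists c; apply/and4P.
Qed.

Lemma words_word_of n w : w \in words n -> exists s, w = word_of n s.
Proof.
move=> wn; exists [ffun i : 'I_n => insubd i (nth 0 w i)].
apply: (@eq_from_nth _ 0); first by rewrite size_word_of (size_words n).
move=> i; rewrite (size_words _ _ wn) => lti.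
rewrite (nth_word_of _ _ (Ordinal lti)) ffunE val_insubd /=.
move: wn; rewrite mem_words => /andP[_ /forallP/(_ (Ordinal lti))/andP[lei _]].
by rewrite (leq_ltn_trans lei lti).
Qed.

Lemma num_avoidingE n : num_avoiding n = num_ext n 0 0.
Proof.
rewrite -size_wordsE /num_avoiding cardE -(size_map (word_of n)).
apply/eqP; rewrite -uniq_size_uniq ?words_uniq //.
  by rewrite map_inj_uniq ?enum_uniq //; apply: word_of_inj.
move=> w; apply/idP/mapP => [wn|[s]]; last first.
  by rewrite mem_enum inE -word_of_in_words => ? ->.
have [s ws] := words_word_of n w wn; exists s => //.
by rewrite mem_enum inE -word_of_in_words -ws.
Qed.

End Words.

(** * The linear system and its solution *)

Section Series.

Local Notation t := (fpsX rat).

Lemma fpscoefD (f g : fps rat) n : (f + g)`[n] = f`[n] + g`[n].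
Proof. by []. Qed.

Lemma fpscoefN (f : fps rat) n : (- f)`[n] = - f`[n].
Proof. by []. Qed.

Lemma fpscoef_sum (I : Type) (r : seq I) (F : I -> fps rat) n :
  (\sum_(i <- r) F i)`[n] = \sum_(i <- r) (F i)`[n].
Proof. exact: (big_morph (fun f : fps rat => f`[n])). Qed.

Lemma fpscoefMn (f : fps rat) k n : (k%:R * f)`[n] = k%:R * f`[n].
Proof.
rewrite !mulr_natl; elim: k => [|k IHk]; first by rewrite !mulr0n.
by rewrite !mulrS fpscoefD IHk.
Qed.

Lemma fpscoefX0 (f : fps rat) : (t * f)`[0] = 0.
Proof. by rewrite fpscoefM0 mul0r. Qed.

Lemma fpscoefXS (f : fps rat) n : (t * f)`[n.+1] = f`[n].
Proof.
rewrite fpscoefM 2!big_ord_recl /= mul0r mul1r add0r subn1 big1 ?addr0 //.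
by move=> i _; rewrite mul0r.
Qed.

(* The m-th coefficients on the right depend only on (m-1)-st ones of G, so    *)
(* the system has at most one solution. *)
Lemma num_ext_fps (G : nat -> nat -> fps rat) :
  (forall k l, G k l = 1 + t * (k%:R * G 1%N l.+1 +
     \sum_(j < l.+1) G (k + j)%N (l.+1 - j)%N)) ->
  forall k l, Fps (fun m => (num_ext m k l)%:R) = G k l.
Proof.
move=> HG k l; apply/fpsP => m /=.
elim: m k l => [|m IHm] k l; rewrite HG fpscoefD.
  by rewrite fpscoefX0 addr0.
rewrite fpscoefXS add0r fpscoefD fpscoefMn fpscoef_sum /=.
rewrite natrD natrM natr_sum IHm; congr (_ + _).
by apply: eq_bigr => j _; rewrite IHm.
Qed.

Section Closed_form.

Variables mu : fps rat.
Hypothesis mu_eq : mu = 1 + 2 * t * mu ^+ 2.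

(* G(k, l) without its denominator. *)
Definition closed_form (k l : nat) : fps rat :=
  1 + mu ^+ l + 2 * t * (k%:R - 1) * mu ^+ l.+1.

Lemma closed_form_step k l : closed_form k l = 2 * (1 - t - t * mu) +
  t * (k%:R * closed_form 1 l.+1 +
       \sum_(j < l.+1) closed_form (k + j) (l.+1 - j)).
Proof.
have root_mu : 2 * t * mu ^+ 2 - mu + 1 = 0 by rewrite [X in _ - X]mu_eq; ring.
elim: l k => [|l IHl] k; apply/eqP; rewrite -subr_eq0; apply/eqP.
  rewrite big_ord1 addn0 subn0 /closed_form !exprS expr0.
  by rewrite -[RHS](mulr0 (- t * (k%:R - 1))) -root_mu; ring.
(* Without its term [j = 0], the sum for [(k, l.+1)] is the sum for [(k.+1, l)], which the induction
   hypothesis evaluates. *)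
rewrite big_ord_recl addn0 subn0.
rewrite (eq_bigr (fun j : 'I_l.+1 => closed_form (k.+1 + j) (l.+1 - j))); last first.
  by move=> j _; rewrite !lift0 addnS -addSn subSS.
have := IHl k.+1; set S := \sum_(j < _) _ => IH.
have -> : t * (k%:R * closed_form 1 l.+2 + (closed_form k l.+2 + S)) =
    t * (k%:R * closed_form 1 l.+2 + closed_form k l.+2) +
    (closed_form k.+1 l - 2 * (1 - t - t * mu)
     - t * (k.+1%:R * closed_form 1 l.+1)) by rewrite IH; ring.
rewrite /closed_form -[k.+1%:R]natr1 !exprS.
by rewrite -[RHS](mulr0 (- mu ^+ l * (1 + t * (k%:R - 1) * mu))) -root_mu; ring.
Qed.

End Closed_form.

End Series.

Theorem theorem3p3 :
  let t : fps rat := fpsX rat in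
  Fps (fun n : nat => (num_avoiding n)%:R : rat) =
  (2 - t - t * fps_sqrt (1 - 8 * t)) / (4 * t ^+ 2 - 4 * t + 2).
Proof.
move=> t; set s := fps_sqrt _.
have s2 : s ^+ 2 = 1 - 8 * t 
  by rewrite /s fps_sqrtK // mulrC fpscoefD fpscoefN fpscoefX0 subr0.
have unit_s : 1 + s \is a GRing.unit.
  by rewrite fps_unitE fpscoefD fps_sqrt0.
(* This is [(1 - s) / (4 * t)] rationalised, because [t] is not invertible. *)
pose mu := 2 / (1 + s).
have mu_s : mu * (1 + s) = 2 by rewrite divrK.
have s_mu : s = 1 - 4 * t * mu.
  apply: (mulIr unit_s).
  have -> : (1 - 4 * t * mu) * (1 + s) = 1 + s - 4 * t * (mu * (1 + s)) by ring.
  have -> : s * (1 + s) = s + s ^+ 2 by ring.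
  by rewrite s2 mu_s; ring.
have mu_eq : mu = 1 + 2 * t * mu ^+ 2.
  apply: (mulIr unit_s).
  have -> : (1 + 2 * t * mu ^+ 2) * (1 + s) = 1 + s + 2 * t * mu * (mu * (1 + s)).
    by ring.
  by rewrite mu_s s_mu; ring.
pose d := 2 * (1 - t - t * mu).
have unit_d : d \is a GRing.unit.
  by rewrite fps_unitE fpscoefM0 !fpscoefD !fpscoefN fpscoefX0.
have -> : Fps (fun n => (num_avoiding n)%:R : rat) = closed_form mu 0 0 / d.
  rewrite -(num_ext_fps (fun k l => closed_form mu k l / d)).
    by apply/fpsP => n /=; rewrite num_avoidingE.
  move=> k l; rewrite [in LHS](closed_form_step _ mu_eq) -/d.
  by rewrite mulrDl divrr // -mulrA mulrDl mulrA mulr_suml.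
have unit_q : 4 * t ^+ 2 - 4 * t + 2 \is a GRing.unit.
  have -> : 4 * t ^+ 2 - 4 * t + 2 = t * (4 * t - 4) + 2 by ring.
  by rewrite fps_unitE fpscoefD fpscoefX0.
apply: (mulIr unit_q); rewrite divrK //; apply: (mulIr unit_d).
rewrite mulrAC divrK // s_mu /closed_form /d.
apply/eqP; rewrite -subr_eq0; apply/eqP.
have root_mu : 2 * t * mu ^+ 2 - mu + 1 = 0 by rewrite [X in _ - X]mu_eq; ring.
(* The cross products differ by [4 * t ^+ 2] times the quadratic that vanishes at [mu]. *)
by rewrite -[RHS](mulr0 (4 * t ^+ 2)) -root_mu -/t expr0 expr1; ring.
Qed.
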